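(* The maximum likelihood problem (for estimating $\mu\in\mathcal{M}_+(K)$ from the numbers of detections $n_i$ and the detection times $t^i_j$, $j=1,\dots,n_i$, $i=1,\dots,m$) is given by $$\min_{\mu\in\mathcal{M}_+(K)}\ell(\mu),$$ where $$\ell(\mu):=\langle\mu,f\rangle-\sum_{\gamma\in\Gamma}\log\big(\langle\mu,\gamma\rangle\big),$$ with the convention that $\ell(\mu)=+\infty$ for $\mu$ not in $$\operatorname{dom}(\ell):=\{\mu\in\mathcal{M}_+(K):\ \langle\mu,\gamma\rangle>0,\ \gamma\in\Gamma\}.$$
   Context: $K\subset\mathbb{R}^p$ is compact. $\mathcal{C}(K)$ is the space of continuous functions on $K$; $\mathcal{M}(K)$ is its topological dual (Radon measures), endowed with its weak-$*$ topology, $\mathcal{M}_+(K)$ is the set of nonnegative measures, and $\langle\mu,g\rangle=\int_K g\,d\mu$ for $\mu\in\mathcal{M}(K)$, $g\in\mathcal{C}(K)$. The functions $a_1,\dots,a_m$ satisfy $a_i\in\mathcal{C}(K)$, $a_i\ge0$. The operator $A:\mathcal{M}(K)\to\mathbb{R}^m$ is $(A\mu)_i=\langle\mu,a_i\rangle$, $i=1,\dots,m$; its adjoint $A^*:\mathbb{R}^m\to\mathcal{C}(K)$ is $A^*\lambda=\sum_{i=1}^m\lambda_i a_i$, and $\boldsymbol{1}=(1,\dots,1)\in\mathbb{R}^m$. For each $t\in[0,1]$, $\mathcal{W}_t:\mathcal{M}(K)\to\mathcal{M}(K)$ is a known linear operator, continuous in the weak-$*$ topology, with adjoint $\mathcal{W}_t^*:\mathcal{C}(K)\to\mathcal{C}(K)$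 given by $\langle\mathcal{W}_t\mu,g\rangle=\langle\mu,\mathcal{W}_t^*g\rangle$. Standing assumptions: (nonnegativity preservation) $\mu\ge0\Rightarrow\mathcal{W}_t\mu\ge0$ for all $t\in[0,1]$; (integrability) $\int_{[0,1]\times K}\mathcal{W}_t^*1<+\infty$, where $1$ denotes the constant function in $\mathcal{C}(K)$; (positivity) the function $f:=\int_0^1\mathcal{W}_t^*A^*\boldsymbol{1}\,dt$, which the integrability condition allows one to define, satisfies $f(x)\ge c$ for all $x\in K$, for some constant $c>0$. Data: for each detector $i\in\{1,\dots,m\}$, a number $n_i$ of detections and detection times $t^i_j\in[0,1]$, $j=1,\dots,n_i$; $n=\sum_{i=1}^m n_i$. For the unknown $\mu\in\mathcal{M}_+(K)$, these are drawn from $m$ independent inhomogeneous (in time) Poisson processes on $[0,1]$ with respective intensities $\beta_i(t)=(A\mathcal{W}_t\mu)_i=\langle\mathcal{W}_t\mu,a_i\rangle$, $i=1,\dots,m$. $\Gamma$ is the collection of the $n$ continuous functions $\mathcal{W}_{t^i_j}^*a_i$, $i=1,\dots,m$, $j=1,\dots,n_i$. Negative log-likelihoods are taken up to constants: for an inhomogeneous Poisson point process on $[0,1]$ of intensity $\beta\in L^1(0,1)$ with $N$ observed points at times $t_1,\dots,t_N$, the negative log-likelihood is, up to constants, $\int_0^1\beta(t)\,dt-\sum_{j=1}^N\log(\beta(t_j))$. *)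

(* Defs.v *)
From HB Require Import structures.
From mathcomp Require Import all_boot all_order all_algebra.
From mathcomp Require Import all_classical all_reals all_analysis.

Set Implicit Arguments.
Unset Strict Implicit.
Unset Printing Implicit Defensive.

Import Order.TTheory GRing.Theory Num.Theory.
Import numFieldNormedType.Exports.

Local Open Scope classical_set_scope.
Local Open Scope ring_scope.
Local Open Scope ereal_scope.

Notation borel_rV R p := (g_sigma_algebraType (@open 'rV[R]_p)).

Notation charge_rV R p := (charge (borel_rV R p) R).

(* By uniqueness of measures agreeing on boxes, this singles out the Lebesgue
   measure of R^p. *)
Definition is_lebesgue_measure (R : realType) (p : nat)
    (leb : set (borel_rV R p) -> \bar R) : Prop :=
  forall u v : 'rV[R]_p, (forall i, (u ord0 i <= v ord0 i)%R) ->
    leb [set x : 'rV[R]_p | forall i, (u ord0 i <= x ord0 i <= v ord0 i)%R]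
    = (\prod_(i < p) (v ord0 i - u ord0 i))%R%:E.

(* Since R^p is a complete separable metric space, the Radon measures on K are
   the finite signed Borel measures of R^p that vanish outside K.  Charges are
   total functions on sets, whose values on nonmeasurable sets are irrelevant. *)
Section measures_on_K.
Context {R : realType} {p : nat}.
Variable K : set 'rV[R]_p.

Definition radon (nu : charge_rV R p) : Prop :=
  forall A : set (borel_rV R p), measurable A -> A `&` K = set0 -> nu A = 0.

Definition charge_ge0 (nu : charge_rV R p) : Prop :=
  forall A : set (borel_rV R p), measurable A -> 0 <= nu A.

Definition charge_eq (nu1 nu2 : charge_rV R p) : Prop :=
  forall A : set (borel_rV R p), measurable A -> nu1 A = nu2 A.

Definition radon_ge0 : set (charge_rV R p) := [set nu | radon nu /\ charge_ge0 nu].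

(* Only the values on K matter. *)
Definition cont_on (g : 'rV[R]_p -> R) : Prop := {within K, continuous g}.

Lemma hahn_ex (nu : charge_rV R p) :
  exists PN : set (borel_rV R p) * set (borel_rV R p),
    hahn_decomposition nu PN.1 PN.2.
Proof. by have [P [N PN]] := Hahn_decomposition nu; exists (P, N). Qed.

Definition hahn_sets (nu : charge_rV R p) :
  hahn_decomposition nu (sval (cid (hahn_ex nu))).1 (sval (cid (hahn_ex nu))).2
  := svalP (cid (hahn_ex nu)).

(* The integral of an extended-real-valued function over K against a signed
   measure.  For nu >= 0 the negative part is null, so that this is
   the usual integral when g >= 0, possibly +oo. *)
Definition epairing (nu : charge_rV R p) (g : 'rV[R]_p -> \bar R) : \bar R :=
  \int[jordan_pos (hahn_sets nu)]_(x in K) g x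
  - \int[jordan_neg (hahn_sets nu)]_(x in K) g x.

Definition pairing (nu : charge_rV R p) (g : 'rV[R]_p -> R) : R :=
  fine (epairing nu (EFin \o g)).

Definition linear_on_radon (V : charge_rV R p -> charge_rV R p) : Prop :=
  forall (r : R) (nu1 nu2 : charge_rV R p), radon nu1 -> radon nu2 ->
    charge_eq (V (cadd (cscale r nu1) nu2))
              (cadd (cscale r (V nu1)) (V nu2)).

(* Finite intersections of strips { |<nu' - nu, h>| < delta } are a
   neighbourhood base of nu in the weak-* topology. *)
Definition weakstar_continuous (V : charge_rV R p -> charge_rV R p) : Prop :=
  forall (nu : charge_rV R p) (g : 'rV[R]_p -> R), radon nu -> cont_on g ->
  forall eps : R, (0 < eps)%R ->
  exists (k : nat) (h : 'I_k -> 'rV[R]_p -> R) (delta : R),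
    [/\ forall j, cont_on (h j), (0 < delta)%R &
      forall nu' : charge_rV R p, radon nu' ->
        (forall j, `|pairing nu' (h j) - pairing nu (h j)| < delta)%R ->
        (`|pairing (V nu') g - pairing (V nu) g| < eps)%R].

Record weakstar_operator (V : charge_rV R p -> charge_rV R p)
    (Vadj : ('rV[R]_p -> R) -> 'rV[R]_p -> R) : Prop := {
  wso_radon : forall nu, radon nu -> radon (V nu);
  wso_linear : linear_on_radon V;
  wso_continuous : weakstar_continuous V;
  wso_adj_cont : forall g, cont_on g -> cont_on (Vadj g);
  wso_adjoint : forall nu g, radon nu -> cont_on g ->
    pairing (V nu) g = pairing nu (Vadj g) }.

End measures_on_K.

Section poisson_likelihood.
Context {R : realType}.

(* Likelihood of N points at times s in [0,1] for the intensity beta, without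
   its normalising constant; expeR (-oo) = 0. *)
Definition poisson_likelihood (beta : R -> R) (N : nat) (s : 'I_N -> R) : R :=
  (fine (expeR (- \int[@lebesgue_measure R]_(u in `[0%R, 1%R]) (beta u)%:E))
   * \prod_(j < N) beta (s j))%R.

(* The likelihood of m independent processes is the product of the individual
   ones.  The factor c i > 0 is the constant up to which the likelihood of the
   i-th process is defined (for instance 1, or 1 / (N i)!). *)
Definition joint_likelihood (m : nat) (c : 'I_m -> R) (beta : 'I_m -> R -> R)
    (N : 'I_m -> nat) (s : forall i, 'I_(N i) -> R) : R :=
  (\prod_(i < m) (c i * poisson_likelihood (beta i) (s i)))%R.

End poisson_likelihood.

Section model.
Context {R : realType} {p m : nat}.
Variables (K : set 'rV[R]_p) (a : 'I_m -> 'rV[R]_p -> R).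
Variables (W : R -> charge_rV R p -> charge_rV R p).
Variables (Wadj : R -> ('rV[R]_p -> R) -> 'rV[R]_p -> R).
Variables (n : 'I_m -> nat) (t : forall i : 'I_m, 'I_(n i) -> R).

Definition A_op (nu : charge_rV R p) : 'rV[R]_m := (\row_i pairing K nu (a i))%R.

Definition A_adj (lambda : 'rV[R]_m) (x : 'rV[R]_p) : R :=
  (\sum_(i < m) lambda ord0 i * a i x)%R.

(* An integral of a function that is nonnegative on K, hence in [0, +oo]. *)
Definition sensitivity (x : 'rV[R]_p) : \bar R :=
  \int[@lebesgue_measure R]_(u in `[0%R, 1%R])
    (Wadj u (A_adj (const_mx 1%R)) x)%:E.

Definition intensity (mu : charge_rV R p) (i : 'I_m) (u : R) : R :=
  (A_op (W u mu)) ord0 i.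

Definition likelihood (c : 'I_m -> R) (mu : charge_rV R p) : R :=
  joint_likelihood c (intensity mu) t.

(* lne 0 = -oo, so that this is +oo where the likelihood vanishes. *)
Definition neg_log_likelihood (c : 'I_m -> R) (mu : charge_rV R p) : \bar R :=
  - lne (likelihood c mu)%:E.

Definition max_likelihood (c : 'I_m -> R) : set (charge_rV R p) :=
  [set mu | radon_ge0 K mu /\
    forall nu, radon_ge0 K nu -> (likelihood c nu <= likelihood c mu)%R].

Definition gamma (i : 'I_m) (j : 'I_(n i)) : 'rV[R]_p -> R := Wadj (t j) (a i).

Definition dom_ell : set (charge_rV R p) :=
  [set mu | radon_ge0 K mu /\
    forall (i : 'I_m) (j : 'I_(n i)), (0 < pairing K mu (gamma j))%R].

Definition ell (mu : charge_rV R p) : \bar R :=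
  if `[< dom_ell mu >] then
    epairing K mu sensitivity
    - (\sum_(i < m) \sum_(j < n i) ln (pairing K mu (gamma j)))%R%:E
  else +oo.

Definition argmin_ell : set (charge_rV R p) :=
  [set mu | radon_ge0 K mu /\ forall nu, radon_ge0 K nu -> ell mu <= ell nu].

End model.

(* Main.v *)
Require Import Defs.
From mathcomp Require Import all_boot all_order all_algebra.
From mathcomp Require Import all_classical all_reals all_analysis measurable_realfun.
From mathcomp Require Import ring.
Import Order.TTheory GRing.Theory Num.Theory.
Import numFieldNormedType.Exports.
Local Open Scope classical_set_scope.
Local Open Scope ring_scope.
Local Open Scope ereal_scope.

(* Testing the adjoint relation on Dirac masses shows that Wadj u is additive and
   preserves nonnegativity on K, so the sensitivity is on K the time integral of
   \sum_i Wadj u (a i).  Tonelli's theorem for the product of the Lebesgue measure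
   on [0,1] and mu then identifies <mu, f> with the total expected number of
   detections \sum_i \int_0^1 beta_i, as an identity in [0, +oo].  Taking -ln of
   the product of the Poisson likelihoods gives ell up to an additive constant;
   both sides are +oo when some beta_i(t_j) = 0 or some beta_i has infinite
   integral. *)

Set Implicit Arguments.
Unset Strict Implicit.

(** * Continuous functions on a compact set: Borel measurability and integrability *)

Section borel_rV.
Context {R : realType} {p : nat} (K : set 'rV[R]_p).
Hypothesis K_compact : compact K.

Lemma compact_measurable_rV : measurable (K : set (borel_rV R p)).
Proof.
rewrite -[K]setCK; apply: measurableC; apply: sub_sigma_algebra.
exact/closed_openC/(compact_closed (@norm_hausdorff _ _) K_compact).
Qed.

Lemma cont_on_measurable (g : 'rV[R]_p -> R) : cont_on K g ->
  measurable_fun (K : set (borel_rV R p)) (g : borel_rV R p -> R).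
Proof.
(* Bounded open intervals generate the Borel sets of the line, and continuity within [K] makes the
   preimage of each of them the trace on [K] of an open set. *)
move=> /continuousP gc; apply: (measurability _ (RGenOpens.measurableE R)).
move=> _ [_ [u [v ->] <-]].
have /open_subspaceP[V oV VK] :=
  gc _ (@interval_open R (BRight u) (BLeft v) isT isT).
rewrite setIC -VK; apply: measurableI; last exact: compact_measurable_rV.
exact: sub_sigma_algebra.
Qed.

Lemma cont_on_integrable (nu : {finite_measure set (borel_rV R p) -> \bar R})
    (g : 'rV[R]_p -> R) : cont_on K g -> nu.-integrable K (EFin \o g).
Proof.
move=> gc; apply: measurable_bounded_integrable.
- exact: compact_measurable_rV.
- by rewrite ltey_eq fin_num_measure//; exact: compact_measurable_rV.
- exact: cont_on_measurable.
(* The image of [K] under [g] is compact, hence bounded; a bounded function is integrable on a set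
   of finite measure. *)
- have [M [Mr MH]] := compact_bounded (continuous_compact gc K_compact).
  exists M; split => // x Mx y Ky; apply: (MH _ Mx); by exists y.
Qed.

End borel_rV.

(** * Tonelli's theorem on a rectangle *)

Section fubini_tonelli_on.
Context d1 d2 (T1 : measurableType d1) (T2 : measurableType d2) (R : realType).
Variable m1 : {sigma_finite_measure set T1 -> \bar R}.
Variable m2 : {sigma_finite_measure set T2 -> \bar R}.
Variables (A : set T1) (B : set T2) (f : T1 -> T2 -> \bar R).
Hypotheses (mA : measurable A) (mB : measurable B).
Hypothesis mf : 
  measurable_fun ((A `*` B) : set (T1 * T2)) (fun z : T1 * T2 => f z.1 z.2).
Hypothesis f0 : forall x y, A x -> B y -> 0 <= f x y.

(** Extension by zero outside the rectangle reduces everything to Tonelli on the whole product; the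
    partial integrals of [g] are the zero extensions of those of [f]. *)
Let g := (fun z : T1 * T2 => f z.1 z.2) \_ (A `*` B).

Let mg : measurable_fun setT g.
Proof. by apply/(measurable_restrictT _ _).1 => //; exact: measurableX. Qed.

Let g0 z : 0 <= g z.
Proof.
by rewrite /g patchE; case: ifPn => //; rewrite inE; case: z => x y [/= Ax By];
  exact: f0.
Qed.

Let integral_patchl y :
  \int[m1]_x g (x, y) = ((fun y => \int[m1]_(x in A) f x y) \_ B) y.
Proof.
rewrite patchE; case: ifPn => [|] yB.
  rewrite [RHS]integral_mkcond; apply: eq_integral => x _.
  by rewrite /g !patchE in_setX /= yB andbT.
by apply: integral0_eq => x _; rewrite /g patchE in_setX /= (negbTE yB) andbF.
Qed.

Let integral_patchr x :
  \int[m2]_y g (x, y) = ((fun x => \int[m2]_(y in B) f x y) \_ A) x.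
Proof.
rewrite patchE; case: ifPn => [|] xA.
  rewrite [RHS]integral_mkcond; apply: eq_integral => y _.
  by rewrite /g !patchE in_setX /= xA.
by apply: integral0_eq => y _; rewrite /g patchE in_setX /= (negbTE xA).
Qed.

Lemma fubini_tonelli_on :
  \int[m1]_(x in A) \int[m2]_(y in B) f x y =
  \int[m2]_(y in B) \int[m1]_(x in A) f x y.
Proof.
rewrite integral_mkcond [RHS]integral_mkcond.
under eq_integral do rewrite -integral_patchr.
under [RHS]eq_integral do rewrite -integral_patchl.
exact: fubini_tonelli.
Qed.

Lemma measurable_integral_on :
  measurable_fun A (fun x => \int[m2]_(y in B) f x y).
Proof.
apply/(measurable_restrictT _ _).2 => //.
rewrite -(funext integral_patchr).
exact: measurable_fun_fubini_tonelli_F.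
Qed.

End fubini_tonelli_on.

(** * Jordan decomposition of a nonnegative charge *)

Section jordan_ge0.
Context d (T : measurableType d) (R : realType).
Variables (nu : {charge set T -> \bar R}) (P N : set T).
Hypothesis nuPN : hahn_decomposition nu P N.
Hypothesis nu_ge0 : forall A, measurable A -> 0 <= nu A.

(** The negative part of [A] is minus the charge of the intersection of [A] with [N], which is
    nonpositive because [N] is a negative set and nonnegative by hypothesis. *)
Lemma jordan_neg_ge0 (A : set T) : measurable A -> jordan_neg nuPN A = 0.
Proof.
move=> mA; have [_ [mN N0] _ _] := nuPN.
have mAN : measurable (A `&` N) by exact: measurableI.
rewrite jordan_negE cjordan_negE /crestr0 mem_set// /crestr.
by apply/eqP; rewrite oppe_eq0 eq_le nu_ge0// andbT N0.
Qed.

Lemma jordan_pos_ge0 (A : set T) : measurable A -> jordan_pos nuPN A = nu A.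
Proof.
move=> mA.
have -> : nu A = jordan_pos nuPN A + (-1)%:E * jordan_neg nuPN A.
  exact: jordan_decomp.
by rewrite jordan_neg_ge0// mule0 adde0.
Qed.

End jordan_ge0.

(** * The pairing with a nonnegative charge as an ordinary integral *)

Section nonnegative_charge.
Context {R : realType} {p : nat} (K : set 'rV[R]_p).
Variable nu : charge_rV R p.
Hypothesis nu_ge0 : charge_ge0 nu.

Lemma epairing_ge0E (g : 'rV[R]_p -> \bar R) :
  epairing K nu g = \int[jordan_pos (hahn_sets nu)]_(x in K) g x.
Proof.
rewrite /epairing [X in _ - X](_ : _ = 0) ?sube0//.
by rewrite (eq_measure_integral mzero) ?integral_measure_zero// => A mA _;
  exact: jordan_neg_ge0.
Qed.

Hypothesis K_compact : compact K.

(** The [fine] in [pairing] loses nothing here: a continuous function on [K] has a finite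
    integral. *)
Lemma pairing_ge0E (g : 'rV[R]_p -> R) : cont_on K g ->
  (pairing K nu g)%:E = \int[jordan_pos (hahn_sets nu)]_(x in K) (g x)%:E.
Proof.
move=> gc; rewrite /pairing epairing_ge0E fineK//.
have gi := cont_on_integrable K_compact (jordan_pos (hahn_sets nu)) gc.
apply: integrable_fin_num gi; exact: compact_measurable_rV.
Qed.

Lemma pairing_ge0 (g : 'rV[R]_p -> R) : cont_on K g ->
  (forall x, K x -> 0 <= g x)%R -> (0 <= pairing K nu g)%R.
Proof.
move=> gc g0; rewrite -lee_fin pairing_ge0E//.
by apply: integral_ge0 => x Kx; rewrite lee_fin g0.
Qed.

Lemma pairing_sum (m : nat) (g : 'I_m -> 'rV[R]_p -> R) :
  (forall i, cont_on K (g i)) ->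
  cont_on K (fun x => \sum_(i < m) g i x)%R ->
  pairing K nu (fun x => \sum_(i < m) g i x)%R =
  (\sum_(i < m) pairing K nu (g i))%R.
Proof.
move=> gc sgc; apply: EFin_inj; rewrite pairing_ge0E// -sumEFin.
under eq_integral do rewrite -sumEFin.
rewrite integral_sum//.
- by apply: eq_bigr => i _; rewrite pairing_ge0E.
- exact: compact_measurable_rV.
- by move=> i; exact: cont_on_integrable.
Qed.

End nonnegative_charge.

(** * Dirac masses as test charges *)

Section dirac_charge.
Context {R : realType} {p : nat} (K : set 'rV[R]_p).
Hypothesis K_compact : compact K.

Definition dirac_charge (x : 'rV[R]_p) : charge_rV R p :=
  charge_of_finite_measure (@dirac _ (borel_rV R p) x R).

Lemma dirac_charge_radon_ge0 (x : 'rV[R]_p) : K x ->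
  radon_ge0 K (dirac_charge x).
Proof.
move=> Kx; split=> [A mA AK0|A mA]; last exact: measure_ge0.
rewrite /= /charge_of_finite_measure diracE memNset// => Ax.
by have : (A `&` K) x by []; rewrite AK0.
Qed.

Lemma pairing_dirac (x : 'rV[R]_p) (g : 'rV[R]_p -> R) : K x -> cont_on K g ->
  pairing K (dirac_charge x) g = g x.
Proof.
move=> Kx gc; have [_ d0] := dirac_charge_radon_ge0 Kx.
apply: EFin_inj; rewrite pairing_ge0E//.
(* The Jordan positive part comes from a chosen Hahn decomposition; by nonnegativity it still agrees
   with the Dirac measure on measurable sets. *)
rewrite (eq_measure_integral (@dirac _ (borel_rV R p) x R)); last first.
  by move=> A mA _; exact: jordan_pos_ge0.
rewrite integral_dirac ?diracE ?mem_set ?mul1e//.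
  exact: compact_measurable_rV.
by apply/measurable_EFinP; exact: cont_on_measurable.
Qed.

End dirac_charge.

(** * Positivity and additivity of the adjoint *)

Section adjoint.
Context {R : realType} {p : nat} (K : set 'rV[R]_p).
Hypothesis K_compact : compact K.
Variables (V : charge_rV R p -> charge_rV R p).
Variables (Vadj : ('rV[R]_p -> R) -> 'rV[R]_p -> R).
Hypothesis V_op : weakstar_operator K V Vadj.
Hypothesis V_ge0 : forall nu, radon_ge0 K nu -> charge_ge0 (V nu).

(** [weakstar_operator] states neither positivity nor additivity of [Vadj]. Writing its point values
    as pairings with the nonnegative charge [V (dirac_charge x)] lets both be inherited from the
    integral. *)
Lemma adjoint_dirac (g : 'rV[R]_p -> R) (x : 'rV[R]_p) : cont_on K g -> K x ->
  Vadj g x = pairing K (V (dirac_charge x)) g.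
Proof.
move=> gc Kx; have [dx _] := dirac_charge_radon_ge0 Kx.
by rewrite (wso_adjoint V_op)// pairing_dirac//; exact: (wso_adj_cont V_op).
Qed.

Lemma adjoint_ge0 (g : 'rV[R]_p -> R) (x : 'rV[R]_p) : cont_on K g ->
  (forall y, K y -> 0 <= g y)%R -> K x -> (0 <= Vadj g x)%R.
Proof.
move=> gc g0 Kx; rewrite adjoint_dirac// pairing_ge0//.
exact/V_ge0/dirac_charge_radon_ge0.
Qed.

Lemma adjoint_sum (m : nat) (g : 'I_m -> 'rV[R]_p -> R) (x : 'rV[R]_p) :
  (forall i, cont_on K (g i)) ->
  cont_on K (fun x => \sum_(i < m) g i x)%R -> K x ->
  Vadj (fun x => \sum_(i < m) g i x)%R x = (\sum_(i < m) Vadj (g i) x)%R.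
Proof.
move=> gc sgc Kx; rewrite adjoint_dirac// pairing_sum//; last first.
  exact/V_ge0/dirac_charge_radon_ge0.
by apply: eq_bigr => i _; rewrite adjoint_dirac.
Qed.

End adjoint.

(** * Finite products under the logarithm and finite sums of continuous functions *)

Lemma ln_prod (R : realType) (I : finType) (F : I -> R) :
  (forall i, 0 < F i)%R -> ln (\prod_i F i)%R = (\sum_i ln (F i))%R.
Proof.
move=> F0.
(* Positivity of the partial products is carried through the induction, since [lnM] requires it. *)
have [_ ->//] : (0 < \prod_i F i)%R /\ ln (\prod_i F i)%R = (\sum_i ln (F i))%R.
apply: (big_rec2 (fun x y => 0 < x /\ ln x = y)%R); first by rewrite ln1.
by move=> i x y _ [x0 <-]; rewrite mulr_gt0// lnM ?posrE.
Qed.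

Lemma cont_on_sum (R : realType) (p m : nat) (K : set 'rV[R]_p)
    (g : 'I_m -> 'rV[R]_p -> R) : (forall i, cont_on K (g i)) ->
  cont_on K (fun x => \sum_(i < m) g i x)%R.
Proof.
move=> gc; have -> : (fun x => \sum_(i < m) g i x)%R = (\sum_(i < m) g i)%R.
  by apply/funext => x; rewrite fct_sumE.
rewrite /cont_on; elim/big_rec: _ => [|i f _ fc]; first exact: cst_continuous.
exact: within_continuousD (gc i) fc.
Qed.

(** * Intensities, sensitivity and the expected number of detections *)

Section detection_model.
Context {R : realType} {p m : nat} (K : set 'rV[R]_p).
Hypothesis K_compact : compact K.
Variable a : 'I_m -> 'rV[R]_p -> R.
Hypothesis a_cont : forall i, cont_on K (a i).
Hypothesis a_ge0 : forall i x, K x -> (0 <= a i x)%R.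
Variables (W : R -> charge_rV R p -> charge_rV R p).
Variables (Wadj : R -> ('rV[R]_p -> R) -> 'rV[R]_p -> R).
Hypothesis W_op : forall u, (0 <= u <= 1)%R -> weakstar_operator K (W u) (Wadj u).
Hypothesis W_ge0 : forall u nu, (0 <= u <= 1)%R -> radon_ge0 K nu ->
  charge_ge0 (W u nu).
Hypothesis W_measurable : forall i,
  measurable_fun ((`[0%R, 1%R] `*` K) : set (R * borel_rV R p))
    (fun z : R * borel_rV R p => Wadj z.1 (a i) z.2).

Let leb := @lebesgue_measure R.

Let Wadj_cont u i : (0 <= u <= 1)%R -> cont_on K (Wadj u (a i)).
Proof. by move=> u01; exact: wso_adj_cont (W_op u01) _ _. Qed.

Let Wadj_ge0 u i x : (0 <= u <= 1)%R -> K x -> (0 <= Wadj u (a i) x)%R.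
Proof.
move=> u01; apply: (adjoint_ge0 K_compact (W_op u01)) => // [nu|y Ky].
- exact: W_ge0.
- exact: a_ge0.
Qed.

Lemma intensityE mu i u : radon K mu -> (0 <= u <= 1)%R ->
  intensity K a W mu i u = pairing K mu (Wadj u (a i)).
Proof. by move=> Kmu u01; rewrite /intensity mxE (wso_adjoint (W_op u01)). Qed.

Lemma intensity_ge0 mu i u : radon_ge0 K mu -> (0 <= u <= 1)%R ->
  (0 <= intensity K a W mu i u)%R.
Proof.
move=> [Kmu mu0] u01; rewrite intensityE//.
by apply: (pairing_ge0 mu0) => //; [exact: Wadj_cont|move=> x; exact: Wadj_ge0].
Qed.

Lemma EFin_intensityE mu i u : radon_ge0 K mu -> (0 <= u <= 1)%R ->
  (intensity K a W mu i u)%:E =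
  \int[jordan_pos (hahn_sets mu)]_(x in K) (Wadj u (a i) x)%:E.
Proof.
by move=> [Kmu mu0] u01; rewrite intensityE// pairing_ge0E//; exact: Wadj_cont.
Qed.

Lemma sensitivityE x : K x -> sensitivity a Wadj x =
  \int[leb]_(u in `[0%R, 1%R]) (\sum_(i < m) Wadj u (a i) x)%:E.
Proof.
move=> Kx; apply: eq_integral => u; rewrite inE /= in_itv /= => u01; congr EFin.
rewrite (_ : A_adj a _ = fun y => \sum_(i < m) a i y)%R; last first.
  by apply/funext => y; apply: eq_bigr => i _; rewrite mxE mul1r.
apply: (adjoint_sum K_compact (W_op u01)) => //; last exact: cont_on_sum.
by move=> nu; exact: W_ge0.
Qed.

(** On [0,1] the intensity is a partial integral of the jointly measurable, nonnegative function
    [Wadj u (a i) x], so its measurability in time is part of Tonelli's theorem. *)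
Lemma measurable_intensity mu i : radon_ge0 K mu ->
  measurable_fun (`[0%R, 1%R] : set R) (EFin \o intensity K a W mu i).
Proof.
move=> mu0; apply: (eq_measurable_fun (fun u =>
    \int[jordan_pos (hahn_sets mu)]_(x in K) (Wadj u (a i) x)%:E)).
  by move=> u; rewrite inE /= in_itv /= => u01; rewrite EFin_intensityE.
apply: (@measurable_integral_on _ _ _ _ R (jordan_pos (hahn_sets mu))
    _ _ (fun u x => (Wadj u (a i) x)%:E)) => //.
- exact: compact_measurable_rV.
- by apply/measurable_EFinP; exact: (W_measurable i).
- by move=> u x; rewrite /= in_itv /= => u01 Kx; rewrite lee_fin Wadj_ge0.
Qed.

Lemma epairing_sensitivity mu : radon_ge0 K mu ->
  epairing K mu (sensitivity a Wadj) =
  \sum_(i < m) \int[leb]_(u in `[0%R, 1%R]) (intensity K a W mu i u)%:E.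
Proof.
move=> mu0; have [_ mu_ge0] := mu0; rewrite epairing_ge0E//.
rewrite -ge0_integral_sum//; last 2 first.
- by move=> i; exact: measurable_intensity.
- move=> i u; rewrite /= in_itv /= => u01.
  by rewrite lee_fin intensity_ge0.
transitivity (\int[jordan_pos (hahn_sets mu)]_(x in K)
    \int[leb]_(u in `[0%R, 1%R]) (\sum_(i < m) Wadj u (a i) x)%:E).
  by apply: eq_integral => x; rewrite inE => Kx; rewrite sensitivityE.
rewrite -(fubini_tonelli_on leb (jordan_pos (hahn_sets mu))
  (f := fun u x => (\sum_(i < m) Wadj u (a i) x)%:E))//; last 3 first.
- exact: compact_measurable_rV.
- by apply/measurable_EFinP; apply: measurable_sum => i; exact: (W_measurable i).
- move=> u x; rewrite /= in_itv /= => u01 Kx.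
  by rewrite lee_fin sumr_ge0// => i _; rewrite Wadj_ge0.
(* After the exchange, what remains at each fixed time is additivity of the pairing with [mu]. *)
apply: eq_integral => u; rewrite inE /= in_itv /= => u01.
rewrite sumEFin (eq_bigr (fun i => pairing K mu (Wadj u (a i)))); last first.
  by move=> i _; rewrite intensityE//; case: mu0.
have Wadj_sum_cont : cont_on K (fun x => \sum_(i < m) Wadj u (a i) x)%R.
  by apply: cont_on_sum => i; exact: Wadj_cont.
rewrite -pairing_sum//; first by rewrite pairing_ge0E.
by move=> i; exact: Wadj_cont.
Qed.

(** By [epairing_sensitivity] the right-hand quantity is a finite sum of nonnegative terms, which is
    finite exactly when each term is; nonnegativity of the intensities turns finite integrals into
    integrability. *)
Lemma integrable_intensityP mu : radon_ge0 K mu ->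
  (forall i, leb.-integrable `[0%R, 1%R] (EFin \o intensity K a W mu i)) <->
  epairing K mu (sensitivity a Wadj) < +oo.
Proof.
move=> mu0; rewrite epairing_sensitivity//.
have I0 i : 0 <= \int[leb]_(u in `[0%R, 1%R]) (intensity K a W mu i u)%:E.
  apply: integral_ge0 => u; rewrite /= in_itv /= => u01.
  by rewrite lee_fin intensity_ge0.
split=> [Ioo|Ioo i].
  by apply: lte_sum_pinfty => i _; exact: integrable_lty (Ioo i).
apply/integrableP; split; first exact: measurable_intensity.
apply: le_lt_trans Ioo.
apply: (@le_trans _ _ (\int[leb]_(u in `[0%R, 1%R]) (intensity K a W mu i u)%:E)).
  rewrite le_eqVlt; apply/orP; left; apply/eqP/eq_integral => u.
  by rewrite inE /= in_itv /= => u01; rewrite ger0_norm// intensity_ge0.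
by rewrite (bigD1 i)//= leeDl// sume_ge0.
Qed.

(** * The likelihood, its negative logarithm and its maximisers *)

Variables (n : 'I_m -> nat) (t : forall i : 'I_m, 'I_(n i) -> R).
Hypothesis t01 : forall i (j : 'I_(n i)), (0 <= t j <= 1)%R.
Variable c : 'I_m -> R.
Hypothesis c_gt0 : forall i, (0 < c i)%R.

Lemma pairing_gamma_ge0 mu i (j : 'I_(n i)) : radon_ge0 K mu ->
  (0 <= pairing K mu (gamma a Wadj t j))%R.
Proof.
move=> mu0; have := intensity_ge0 i mu0 (t01 j).
by rewrite intensityE//; case: mu0.
Qed.

Lemma likelihoodE mu : radon_ge0 K mu ->
  likelihood K a W t c mu =
  (\prod_(i < m) (c i * (fine (expeR (- \int[leb]_(u in `[0%R, 1%R])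
    (intensity K a W mu i u)%:E)) *
    \prod_(j < n i) pairing K mu (gamma a Wadj t j))))%R.
Proof.
move=> [Kmu mu0]; apply: eq_bigr => i _; congr (_ * (_ * _))%R.
by apply: eq_bigr => j _; rewrite intensityE.
Qed.

Lemma likelihood_ge0 mu : radon_ge0 K mu -> (0 <= likelihood K a W t c mu)%R.
Proof.
move=> mu0; rewrite likelihoodE// prodr_ge0// => i _.
rewrite mulr_ge0 ?(ltW (c_gt0 i))// mulr_ge0 ?fine_ge0 ?expeR_ge0//.
by rewrite prodr_ge0// => j _; exact: pairing_gamma_ge0.
Qed.

Lemma neg_log_likelihoodE mu : radon_ge0 K mu ->
  neg_log_likelihood K a W t c mu =
  ell K a Wadj t mu - (\sum_(i < m) ln (c i))%R%:E.
Proof.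
move=> mu0; rewrite /neg_log_likelihood /ell likelihoodE//.
(* Outside [dom_ell] some nonnegative pairing fails to be positive, hence is zero and annihilates
   the likelihood; then [lne] is [-oo] and both sides are [+oo]. *)
case: asboolP => [[_ mu_gt0]|ndom]; last first.
  have [i [j]] : exists i (j : 'I_(n i)), ~ (0 < pairing K mu (gamma a Wadj t j))%R.
    by move: ndom; rewrite /dom_ell /= => /not_andP[//|/existsNP[i /existsNP[j]]];
      exists i, j.
  move/negP; rewrite lt_neqAle pairing_gamma_ge0// andbT negbK => /eqP pij0.
  rewrite le0_lneNy// (bigD1 i)//= [X in (_ * (_ * X))%R](bigD1 j)//= -pij0.
  by rewrite !(mul0r, mulr0).
rewrite epairing_sensitivity//.
pose J i := \int[leb]_(u in `[0%R, 1%R]) (intensity K a W mu i u)%:E.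
rewrite -/(J _).
have J0 i : 0 <= J i.
  apply: integral_ge0 => u; rewrite /= in_itv /= => u01.
  by rewrite lee_fin intensity_ge0.
(* Inside the domain, one infinite expected count gives an exponential factor 0, so the likelihood
   vanishes again, while the sum of the [J i] makes [ell] equal to [+oo]. *)
have [[i Ji]|Jfin] := pselect (exists i, J i = +oo).
  rewrite le0_lneNy; last first.
    by rewrite (bigD1 i)//= -/(J i) Ji /= !(mul0r, mulr0).
  rewrite (bigD1 i)//= -/(J i) Ji addye//.
  (* Absorption by [+oo] requires the other terms of the sum not to add up to [-oo]; they are
     nonnegative. *)
  rewrite -ltNye; apply: (@lt_le_trans _ _ 0) => //.
  by apply: sume_ge0 => k _; exact: J0.
(* With every [J i] finite all factors are positive reals, and the identity becomes one about real
   logarithms. *)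
have JE i : J i = (fine (J i))%:E.
  rewrite fineK// ge0_fin_numE// ltey; apply/eqP => Ji; apply: Jfin; by exists i.
have -> : \sum_(i < m) J i = (\sum_(i < m) fine (J i))%:E.
  by rewrite -sumEFin; apply: eq_bigr => i _; exact: JE.
have lik_gt0 i : (0 < c i * (expR (- fine (J i)) *
    \prod_(j < n i) pairing K mu (gamma a Wadj t j)))%R.
  by rewrite !mulr_gt0 ?expR_gt0 ?prodr_gt0.
under eq_bigr => i _ do rewrite -/(J i) JE /=.
rewrite lne_EFin ?prodr_gt0// ln_prod// -!EFinB -EFinN; congr EFin.
rewrite (eq_bigr (fun i => ln (c i) - fine (J i) +
    \sum_(j < n i) ln (pairing K mu (gamma a Wadj t j)))%R) => [|i _].
  by rewrite !big_split/= sumrN; ring.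
rewrite lnM ?posrE ?mulr_gt0 ?expR_gt0 ?prodr_gt0//.
by rewrite lnM ?posrE ?expR_gt0 ?prodr_gt0// expRK ln_prod// addrA.
Qed.

Lemma max_likelihoodE : max_likelihood K a W t c = argmin_ell K a Wadj t.
Proof.
(* [lne] is order-preserving and order-reflecting on [0, [+oo]], negation reverses the order, and
   the additive constant is finite, so it cancels even where [ell] is [+oo]. *)
have le_ell mu nu : radon_ge0 K mu -> radon_ge0 K nu ->
    (likelihood K a W t c nu <= likelihood K a W t c mu)%R =
    (ell K a Wadj t mu <= ell K a Wadj t nu).
  move=> mu0 nu0; rewrite -lee_fin -lee_lne ?in_itv/= ?leey ?lee_fin ?likelihood_ge0//.
  rewrite -leeN2 -[leLHS]/(neg_log_likelihood K a W t c mu).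
  rewrite -[leRHS]/(neg_log_likelihood K a W t c nu) !neg_log_likelihoodE//.
  by rewrite leeD2rE.
apply/seteqP; split=> mu [mu0 mu_opt]; split=> // nu nu0.
- by rewrite -le_ell// mu_opt.
- by rewrite le_ell// mu_opt.
Qed.

End detection_model.

Theorem corollary2p3
  (R : realType) (p m : nat)
  (leb : {sigma_finite_measure set (borel_rV R p) -> \bar R})
  (leb_lebesgue : is_lebesgue_measure leb)
  (K : set 'rV[R]_p) (K_compact : compact K)
  (a : 'I_m -> 'rV[R]_p -> R)
  (a_cont : forall i, cont_on K (a i))
  (a_ge0 : forall i x, K x -> (0 <= a i x)%R)
  (W : R -> charge_rV R p -> charge_rV R p)
  (Wadj : R -> ('rV[R]_p -> R) -> 'rV[R]_p -> R)
  (W_op : forall u, (0 <= u <= 1)%R -> weakstar_operator K (W u) (Wadj u))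
  (W_ge0 : forall u nu, (0 <= u <= 1)%R -> radon_ge0 K nu ->
     charge_ge0 (W u nu))
  (W_measurable : forall i,
     measurable_fun ((`[0%R, 1%R] `*` K) : set (R * borel_rV R p))
       (fun z : R * borel_rV R p => Wadj z.1 (a i) z.2))
  (W_integrable :
     (@lebesgue_measure R \x leb).-integrable (`[0%R, 1%R] `*` K)
       (fun z : R * borel_rV R p => (Wadj z.1 (cst 1%R) z.2)%:E))
  (c0 : R) (c0_gt0 : (0 < c0)%R)
  (f_ge : forall x, K x -> c0%:E <= sensitivity a Wadj x)
  (n : 'I_m -> nat) (t : forall i : 'I_m, 'I_(n i) -> R)
  (t01 : forall i (j : 'I_(n i)), (0 <= t i j <= 1)%R)
  (c : 'I_m -> R) (c_gt0 : forall i, (0 < c i)%R) :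
  [/\ forall mu, radon_ge0 K mu ->
        (forall i u, (0 <= u <= 1)%R -> (0 <= intensity K a W mu i u)%R) /\
        ((forall i, (@lebesgue_measure R).-integrable `[0%R, 1%R]
            (EFin \o intensity K a W mu i)) <->
         epairing K mu (sensitivity a Wadj) < +oo),
      forall mu, radon_ge0 K mu ->
        neg_log_likelihood K a W t c mu
        = ell K a Wadj t mu - (\sum_(i < m) ln (c i))%R%:E &
      max_likelihood K a W t c = argmin_ell K a Wadj t].
Proof.
split.
- move=> mu mu0; split.
    by move=> i u; exact: (intensity_ge0 K_compact a_cont a_ge0 W_op W_ge0).
  exact: (integrable_intensityP K_compact a_cont a_ge0 W_op W_ge0 W_measurable).
- move=> mu; exact: (neg_log_likelihoodE K_compact a_cont a_ge0 W_op W_ge0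
    W_measurable t01 c_gt0).
- exact: (max_likelihoodE K_compact a_cont a_ge0 W_op W_ge0 W_measurable t01
    c_gt0).
Qed.
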